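(* Let $J\subset(0,+\infty)$ be an interval and let $f\colon J\to J$ be a continuous function satisfying $$f^3(x)=\frac{[f(x)]^3}{x^2}\quad\text{for every }x\in J,$$ where $f^3=f\circ f\circ f$ and $[f(x)]^3$ is the cube of the number $f(x)$. Then the following hold. (i) If $J$ is bounded and $0\notin\mathrm{cl}\,J$, then $f(x)=x$ for every $x\in J$. (ii) If $J$ is bounded and $0\in\mathrm{cl}\,J$, then there exists $c\in(0,1]$ such that $f(x)=cx$ for every $x\in J$. (iii) If $J$ is unbounded and $0\notin\mathrm{cl}\,J$, then there exists $c\in[1,+\infty)$ such that $f(x)=cx$ for every $x\in J$. (iv) If $J=(0,+\infty)$, then there exists $c\in(0,+\infty)$ such that either $f(x)=cx$ for every $x\in(0,+\infty)$, or $f(x)=\dfrac{c}{x^2}$ for every $x\in(0,+\infty)$.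
   Context: For a self-mapping $f\colon J\to J$, $f^n$ denotes the $n$-th iterate: $f^0=\mathrm{id}_J$ and $f^k=f\circ f^{k-1}$ for all integers $k\ge1$. The (nonempty) interval $J$ may be open, closed, or closed on one side, possibly infinite, or degenerate to a single point. $\mathrm{cl}\,J$ denotes the closure of $J$ in $\mathbb R$. *)

(* Defs.v *)
From mathcomp Require Export all_boot all_order all_algebra.
From mathcomp Require Export all_classical all_reals all_analysis.

Export Order.TTheory GRing.Theory Num.Theory numFieldNormedType.Exports.

Set Implicit Arguments.
Unset Strict Implicit.
Unset Printing Implicit Defensive.

(* Main.v *)
(** In the variable [ln x] the equation becomes [g (g (g x)) = 3 g x - 2 x],
    whose characteristic polynomial is [(t - 1)^2 (t + 2)]; hence orbits have
    the form [a + b n + c (-2)^n], and [g] is injective, so strictly monotone.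
    If [g] is increasing, or if its domain is bounded on one side, then [c = 0],
    and monotonicity of all iterates forces [g] to be a translation.  If [g] is
    a decreasing self-map of the line, it is onto and has a fixed point [p];
    the distances to [p] satisfy a recurrence with nonnegative coefficients,
    which forces [|g x - p| = 2 |x - p|], i.e. [g x = 3 p - 2 x]. *)

Require Import Defs.
From mathcomp Require Import ring lra.

Local Open Scope classical_set_scope.
Local Open Scope ring_scope.

(** * Growth of the sequences [a + b n + c (-2)^n] *)

Section Sequences.
Set Implicit Arguments.
Unset Strict Implicit.
Variable R : realType.
Implicit Types a b c : R.

Lemma exists_muln_gt a b : 0 < a -> exists n : nat, b < a * n%:R.
Proof.
move=> a_gt0; exists (Num.bound (`|b| / a)).
rewrite mulrC -ltr_pdivrMr //; apply: le_lt_trans (archi_boundP _) => //.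
  by rewrite ler_pM2r ?invr_gt0 // ler_norm.
by apply: divr_ge0 => //; exact: ltW.
Qed.

(** Since [4 ^+ n] is at least [(n + 1) ^+ 2], it suffices to take [n] with [c n] above
    [|a| + |b|]. *)
Lemma exp4_dominates a b c : 0 < c -> exists n, 0 < a + b * n%:R + c * 4 ^+ n.
Proof.
move=> c_gt0.
have sqr_le n : (n%:R + 1) ^+ 2 <= (4 : R) ^+ n.
  elim: n => [|n IHn]; first by rewrite expr0 add0r expr1n.
  rewrite [4 ^+ _]exprS -natr1; have n_ge0 : 0 <= n%:R :> R by [].
  have n2_ge0 : 0 <= n%:R * n%:R :> R by exact: mulr_ge0.
  by lra.
have [n n_gt] := exists_muln_gt (`|a| + `|b|) c_gt0; exists n.
have n_ge0 : 0 <= n%:R :> R by [].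
have := sqr_le n; have := ler_norm (- a); have := ler_norm (- b).
rewrite !normrN => lb la le4.
have h1 : c * (n%:R + 1) ^+ 2 <= c * 4 ^+ n by rewrite ler_pM2l.
have h2 : (`|a| + `|b|) * (n%:R + 1) <= c * n%:R * (n%:R + 1).
  by rewrite ler_pM2r; [exact: ltW|lra].
have a_ge0 := normr_ge0 a; have b_ge0 := normr_ge0 b.
have h3 : 0 <= (b + `|b|) * n%:R by apply: mulr_ge0 => //; lra.
have h4 : 0 <= `|a| * n%:R by exact: mulr_ge0.
have h5 : 0 <= c * n%:R by apply: mulr_ge0 => //; exact: ltW.
by nra.
Qed.

(** Even exponents contribute [c 4^n] and odd ones [-2 c 4^n], so [exp4_dominates] yields both
    signs. Negating all coefficients swaps the two indices, which allows [c > 0]. *)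
Lemma expN2_unbounded a b c : c != 0 ->
  exists n m, 0 < a + b * n%:R + c * (-2) ^+ n /\
              a + b * m%:R + c * (-2) ^+ m < 0.
Proof.
have even n : (-2 : R) ^+ (2 * n) = 4 ^+ n.
  by rewrite exprM; congr (_ ^+ _); ring.
wlog c_gt0 : a b c / 0 < c => [IH|_].
  case: (ltrgtP c 0) => // [c_lt0|c_gt0] _; last first.
    by apply: IH => //; rewrite gt_eqF.
  have [||n [m [n_gt0 m_lt0]]] := IH (- a) (- b) (- c).
  - by rewrite oppr_gt0.
  - by rewrite oppr_eq0 lt_eqF.
  by exists m, n; split; lra.
have [n n_gt0] := exp4_dominates a (2 * b) c_gt0.
have [|m m_gt0] := @exp4_dominates (- a - b) (- (2 * b)) (2 * c); first lra.
exists (2 * n)%N, (2 * m).+1; split.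
  by rewrite even natrM; lra.
by rewrite exprS even -addn1 natrD natrM; lra.
Qed.

End Sequences.

(** * The additive equation on an interval: orbits and translations *)

Section Additive.
Set Implicit Arguments.
Unset Strict Implicit.
Variables (R : realType) (I : set R) (g : R -> R).
Hypotheses (I_itv : is_interval I) (g_II : set_fun I I g).
Hypothesis (g_cont : {within I, continuous g}).
Hypothesis (g_eq : forall x, I x -> g (g (g x)) = 3 * g x - 2 * x).

Lemma iter_in n x : I x -> I (iter n g x).
Proof. by move=> Ix; elim: n => //= n; exact: g_II. Qed.

(** The coefficients fit the first three terms of the orbit; 9 is the second difference of
    [(-2) ^+ n] at 0. As the recurrence has order three, the induction carries three consecutive
    terms. *)
Lemma iter_formula x (c := (g (g x) - 2 * g x + x) / 9) n : I x ->
  iter n g x = x - c + (g x - x + 3 * c) * n%:R + c * (-2) ^+ n.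
Proof.
move=> Ix.
suff [] : [/\ iter n g x = x - c + (g x - x + 3 * c) * n%:R + c * (-2) ^+ n,
  iter n.+1 g x = x - c + (g x - x + 3 * c) * n.+1%:R + c * (-2) ^+ n.+1 &
  iter n.+2 g x = x - c + (g x - x + 3 * c) * n.+2%:R + c * (-2) ^+ n.+2] by [].
elim: n => [|n [IH0 IH1 IH2]].
  by rewrite /= /c !exprS expr0; split; field.
split=> //; have := g_eq (iter_in n Ix); rewrite -!iterS => ->.
rewrite IH0 IH1 !exprS -[n.+3]addn3 -[n.+1]addn1 !natrD; ring.
Qed.

(* The second difference [g (g x) - 2 g x + x] is, up to a factor 9, the
   coefficient of [(-2) ^+ n] in the orbit. *)
Lemma orbit_unbounded x (M : R) : I x -> g (g x) - 2 * g x + x != 0 ->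
  exists n m, M < iter n g x /\ iter m g x < M.
Proof.
move=> Ix d_neq0; set c := (g (g x) - 2 * g x + x) / 9.
have c_neq0 : c != 0 by rewrite mulf_neq0 // invr_eq0.
have [n [m [n_gt0 m_lt0]]] :=
  expN2_unbounded (x - c - M) (g x - x + 3 * c) c_neq0.
exists n, m; rewrite !iter_formula // -/c; split; lra.
Qed.

Lemma iter_arith n x : I x -> (forall y, I y -> g (g y) - 2 * g y + y = 0) ->
  iter n g x = x + (g x - x) * n%:R.
Proof.
by move=> Ix /(_ x Ix) d0; rewrite iter_formula // d0 mul0r; ring.
Qed.

(** If [g x = g y], the third iterates agree as well and the equation returns [x = y]; a continuous
    injection on an interval is strictly monotone. *)
Lemma inc_or_dec : (forall x y, I x -> I y -> x < y -> g x < g y) \/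
                   (forall x y, I x -> I y -> x < y -> g y < g x).
Proof.
have memI x : (x \in Rhull I) = (x \in I).
  by rewrite [in RHS]((is_intervalP I).1 I_itv) mem_setE.
have cont : {within [set` Rhull I], continuous g}.
  by rewrite -(is_intervalP I).1.
have inj : {in Rhull I &, injective g}.
  move=> x y; rewrite !memI !inE => Ix Iy gxy.
  by have := g_eq Ix; have := g_eq Iy; rewrite gxy => ->; lra.
have [mono|mono] := itv_continuous_inj_mono cont inj; [left|right] => x y Ix Iy.
  by apply: mono; rewrite ?memI ?inE.
by apply: mono; rewrite ?memI ?inE.
Qed.

Lemma intermediate_value (h : R -> R) a b v :
    {within I, continuous h} -> I a -> I b -> a <= b ->
    h a <= v <= h b \/ h b <= v <= h a ->
  exists2 z, I z & h z = v.
Proof.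
move=> h_cont Ia Ib ab hv.
have sub : `[a, b]%classic `<=` I.
  by move=> z /=; rewrite in_itv /= => abz; apply: (I_itv Ia Ib).
have [||z zab hz] := @IVT R h a b v ab; last by exists z => //; exact: sub.
- exact: continuous_subspaceW h_cont.
- by rewrite ge_min le_max; case: hv => /andP[-> ->]; rewrite ?orbT.
Qed.

Lemma displacement_continuous : {within I, continuous (fun x => g x - x)}.
Proof.
move=> x; apply: cvgB; first exact: g_cont.
by apply: continuous_subspaceT => y; exact: cvg_id.
Qed.

(* Along an orbit the displacement [g x - x] is constant, and monotonicity of
   all iterates makes it nondecreasing in [x]; an orbit moving right passes
   every larger point, so the displacement takes at most one positive value,
   and likewise at most one negative value. *)
Lemma inc_translation :
    (forall x y, I x -> I y -> x < y -> g x < g y) ->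
    (forall x, I x -> g (g x) - 2 * g x + x = 0) ->
  forall x y, I x -> I y -> g x - x = g y - y.
Proof.
move=> g_inc d0.
have iter_inc n x y : I x -> I y -> x < y -> iter n g x < iter n g y.
  by move=> Ix Iy xy; elim: n => //= n; apply: g_inc; exact: iter_in.
have disp_le x y : I x -> I y -> x < y -> g x - x <= g y - y.
  move=> Ix Iy xy; rewrite leNgt; apply/negP => lt_disp.
  have [|n] := @exists_muln_gt _ (g x - x - (g y - y)) (y - x); first lra.
  by have := iter_inc n _ _ Ix Iy xy; rewrite !iter_arith //; lra.
have disp_iter n x : I x -> g (iter n g x) - iter n g x = g x - x.
  move=> Ix; rewrite -iterS !iter_arith // -addn1 natrD; ring.
have pos_eq x y : I x -> I y -> x < y -> 0 < g x - x -> g x - x = g y - y.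
  move=> Ix Iy xy gx; apply/eqP; rewrite eq_le disp_le //=.
  have [n n_gt] := exists_muln_gt (y - x) gx.
  rewrite -(disp_iter n x) //; apply: disp_le => //; first exact: iter_in.
  by rewrite iter_arith //; lra.
have neg_eq x y : I x -> I y -> x < y -> g y - y < 0 -> g x - x = g y - y.
  move=> Ix Iy xy gy; apply/eqP; rewrite eq_le disp_le //=.
  have [|n n_gt] := @exists_muln_gt _ (- (g y - y)) (y - x); first lra.
  rewrite -(disp_iter n y) //; apply: disp_le => //; first exact: iter_in.
  by rewrite iter_arith //; lra.
suff disp_ge x y : I x -> I y -> x < y -> g y - y <= g x - x.
  have disp_eq u v : I u -> I v -> u < v -> g u - u = g v - v.
    by move=> Iu Iv uv; apply: le_anti; rewrite disp_le ?disp_ge.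
  by move=> x y Ix Iy; case: (ltrgtP x y) => [/disp_eq->|/disp_eq->|->].
move=> Ix Iy xy; rewrite leNgt; apply/negP => lt_disp.
have same_sign u v : I u -> I v ->
    0 < g u - u /\ 0 < g v - v \/ g u - u < 0 /\ g v - v < 0 ->
    g u - u = g v - v.
  move=> Iu Iv uv; case: (ltrgtP u v) uv => [uv|vu|->] // [] [hu hv].
  - exact: pos_eq.
  - exact: neg_eq.
  - by apply/esym; exact: pos_eq.
  - by apply/esym; exact: neg_eq.
(* The value [v] lies strictly between the two displacements and shares the sign of one of them:
   positive like that at [y], or else negative like that at [x]. A point with displacement [v] then
   contradicts [same_sign]. *)
pose v := if 0 < g y - y then (Num.max 0 (g x - x) + (g y - y)) / 2
          else (g x - x + (g y - y)) / 2.
have v_between : g x - x < v < g y - y.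
  rewrite /v; case: ifP => gy; last by apply/andP; split; lra.
  by case: (leP 0 (g x - x)) => gx; apply/andP; split; lra.
have [|z Iz gz] := intermediate_value displacement_continuous Ix Iy (ltW xy)
  (v := v); first by left; case/andP: v_between => *; rewrite !ltW.
move: v_between; rewrite /= /v in gz *; case: ifP gz => gy gz.
  have zpos : 0 < g z - z.
    by rewrite gz; case: (leP 0 (g x - x)) => gx; lra.
  by have := same_sign _ _ Iz Iy (or_introl (conj zpos gy)); rewrite gz; lra.
have gx0 : g x - x < 0 by lra.
have zneg : g z - z < 0 by rewrite gz; lra.
by have := same_sign _ _ Iz Ix (or_intror (conj zneg gx0)); rewrite gz; lra.
Qed.

(** A decreasing [g] reverses the sign of the displacement along an orbit, while a zero second
    difference preserves it; in that case every point is fixed. *)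
Lemma translation_of_arith :
    (forall x, I x -> g (g x) - 2 * g x + x = 0) ->
  forall x y, I x -> I y -> g x - x = g y - y.
Proof.
move=> d0; case: inc_or_dec => [g_inc|g_dec]; first exact: inc_translation.
suff fixed x : I x -> g x = x by move=> x y Ix Iy; rewrite !fixed //; lra.
move=> Ix; have Igx := g_II Ix; have := d0 _ Ix.
case: (ltrgtP (g x) x) => // lt_x.
  by have := g_dec _ _ Igx Ix lt_x; lra.
by have := g_dec _ _ Ix Igx lt_x; lra.
Qed.

(** The orbit of [x] under an increasing map stays on one side of [x], so it cannot be unbounded in
    both directions. *)
Lemma inc_arith : (forall x y, I x -> I y -> x < y -> g x < g y) ->
  forall x, I x -> g (g x) - 2 * g x + x = 0.
Proof.
move=> g_inc x Ix; apply/eqP/negPn/negP => d_neq0.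
have [n [m [n_gt m_lt]]] := orbit_unbounded x Ix d_neq0.
have [le_x|lt_x] := leP x (g x).
  suff : x <= iter m g x by lra.
  elim: (m) => //= k IHk; apply: le_trans le_x _.
  move: IHk; rewrite le_eqVlt => /predU1P[<- //|xk]; apply: ltW.
  by apply: g_inc => //; exact: iter_in.
suff : iter n g x <= x by lra.
elim: (n) => //= k IHk; apply: le_trans (ltW lt_x).
move: IHk; rewrite le_eqVlt => /predU1P[-> //|xk]; apply: ltW.
by apply: g_inc => //; exact: iter_in.
Qed.

Lemma translation_of_half_bounded (M : R) :
    (forall x, I x -> x <= M) \/ (forall x, I x -> M <= x) ->
  forall x y, I x -> I y -> g x - x = g y - y.
Proof.
move=> bnd; apply: translation_of_arith => x Ix; apply/eqP/negPn/negP => d_neq0.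
have [n [m [n_gt m_lt]]] := orbit_unbounded M Ix d_neq0.
case: bnd => bnd; first by have := bnd _ (iter_in n Ix); lra.
by have := bnd _ (iter_in m Ix); lra.
Qed.

Lemma iter_translation n x : (forall x y, I x -> I y -> g x - x = g y - y) ->
  I x -> iter n g x = x + (g x - x) * n%:R.
Proof.
move=> trans Ix; apply: iter_arith => // y Iy.
by have := trans _ _ Iy (g_II Iy); lra.
Qed.

(** Orbits are arithmetic progressions of step [g x - x]; a positive step would eventually pass
    [M]. *)
Lemma bounded_above_le (M : R) x : (forall y, I y -> y <= M) -> I x -> g x <= x.
Proof.
move=> bnd Ix; rewrite leNgt; apply/negP => x_lt.
have trans := translation_of_half_bounded (or_introl bnd).
have [|n n_gt] := @exists_muln_gt _ (g x - x) (M - x); first lra.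
by have := bnd _ (iter_in n Ix); rewrite iter_translation //; lra.
Qed.

Lemma bounded_below_ge (M : R) x : (forall y, I y -> M <= y) -> I x -> x <= g x.
Proof.
move=> bnd Ix; rewrite leNgt; apply/negP => x_lt.
have trans := translation_of_half_bounded (or_intror bnd).
have [|n n_gt] := @exists_muln_gt _ (x - g x) (x - M); first lra.
by have := bnd _ (iter_in n Ix); rewrite iter_translation //; lra.
Qed.

(** * Decreasing solutions on the whole line *)

Section WholeLine.
Hypotheses (I_full : forall x, I x).
Hypothesis g_dec : forall x y, I x -> I y -> x < y -> g y < g x.

Lemma dec_le x y : x <= y -> g y <= g x.
Proof. by rewrite le_eqVlt => /predU1P[-> //|xy]; apply/ltW/g_dec. Qed.

(** The displacement changes sign between [0] and [g 0], because [g] reverses their order. *)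
Lemma fixpoint_exists : exists p, g p = p.
Proof.
have disp := intermediate_value displacement_continuous.
suff [z _ gz] : exists2 z, I z & g z - z = 0 by exists z; lra.
have [g0_ge0|/ltW g0_le0] := leP 0 (g 0).
  apply: (disp 0 (g 0)) => //; right.
  by have := dec_le g0_ge0; rewrite subr0 => le; apply/andP; split; lra.
apply: (disp (g 0) 0) => //; right.
by have := dec_le g0_le0; rewrite subr0 => le; apply/andP; split; lra.
Qed.

Variable p : R.
Hypothesis gp : g p = p.

(** With [x] chosen so that [-2 (x - p) = v - p], the third iterate of [x] is [v + 3 (g x - p)]. It
    lies beyond [v] as seen from [p], so [v] is attained between [p] and [g (g x)]. *)
Lemma dec_surjective v : exists z, g z = v.
Proof.
pose x := p - (v - p) / 2.
have g3x : g (g (g x)) = 3 * g x - 2 * x by exact: g_eq.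
suff [z _ gz] : exists2 z, I z & g z = v by exists z.
have [pv|/ltW vp] := leP p v.
  have xp : x <= p by rewrite /x; lra.
  have := dec_le xp; rewrite gp => pgx; have := dec_le pgx; rewrite gp => ggxp.
  apply: (intermediate_value g_cont _ _ ggxp) => //; right.
  by rewrite gp g3x; apply/andP; split => //; rewrite /x in pgx *; lra.
have px : p <= x by rewrite /x; lra.
have := dec_le px; rewrite gp => gxp; have := dec_le gxp; rewrite gp => pggx.
apply: (intermediate_value g_cont _ _ pggx) => //; right.
by rewrite gp g3x; apply/andP; split => //; rewrite /x in gxp *; lra.
Qed.

Let A w := `|w - p|.

(* [g] exchanges the two sides of [p], so in the distances to [p] the linear
   recurrence has only nonnegative coefficients. *)
Lemma dist_iter3 w : A (g (g (g w))) = 3 * A (g w) + 2 * A w.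
Proof.
rewrite g_eq // /A; have [pw|/ltW wp] := leP p w.
  have := dec_le pw; rewrite gp => gwp.
  by rewrite (ger0_norm (x := w - p)) ?ler0_norm; lra.
have := dec_le wp; rewrite gp => pgw.
by rewrite (ler0_norm (x := w - p)) ?ger0_norm; lra.
Qed.

Lemma dist_iter2 v : 3 * A v <= A (g (g v)).
Proof.
have [w <-] := dec_surjective v; rewrite dist_iter3.
by have : 0 <= A w := normr_ge0 _; lra.
Qed.

(* Distances to [p] contract along backward orbits, so a quantity that they
   dominate and whose size is invariant must vanish. *)
Lemma invariant_eq0 (F : R -> R) :
    (forall w, `|F (g w)| = `|F w|) ->
    (forall w, `|F w| <= 2 * (A (g (g w)) + A (g w) + A w)) ->
  forall w, F w = 0.
Proof.
move=> F_inv F_le.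
have pow_le m w : 3 ^+ m * `|F w| <= 2 * (A (g (g w)) + A (g w) + A w).
  elim: m w => [|m IHm] w; first by rewrite expr0 mul1r.
  (* Going back two steps keeps the size of [F] and, by [dist_iter2], divides the bound by at least
     3. *)
  have [u gu] := dec_surjective w; have [v gv] := dec_surjective u.
  rewrite -gu -gv !F_inv exprS; have := IHm v.
  by have := dist_iter2 v; have := dist_iter2 (g v);
    have := dist_iter2 (g (g v)); lra.
move=> w; apply/eqP; rewrite -normr_eq0; apply/negPn/negP => Fw_neq0.
have Fw_gt0 : 0 < `|F w| by rewrite lt_def Fw_neq0 normr_ge0.
have [m m_gt] :=
  exists_muln_gt (2 * (A (g (g w)) + A (g w) + A w)) Fw_gt0.
have : m%:R <= 3 ^+ m :> R by rewrite -natrX ler_nat ltnW // ltn_expl.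
by rewrite -(ler_pM2l Fw_gt0); have := pow_le m w; lra.
Qed.

Lemma dec_line x : g x = 3 * p - 2 * x.
Proof.
have A_ge0 w : 0 <= A w by exact: normr_ge0.
(* The distances have characteristic polynomial [t^3 - 3 t - 2 = (t - 2) (t + 1)^2]. Here [r]
   applies [(t - 2) (t + 1)] and [q] below applies [t - 2]; the remaining factor [t + 1] makes [r],
   and then [q] once [r = 0], change sign under [g]. *)
pose r w := A (g (g w)) - A (g w) - 2 * A w.
have r0 : forall w, r w = 0.
  apply: invariant_eq0 => w.
    by rewrite -normrN; congr `|_|; rewrite /r dist_iter3; ring.
  have := A_ge0 w; have := A_ge0 (g w); have := A_ge0 (g (g w)).
  by rewrite /r ler_norml => *; apply/andP; split; lra.
pose q w := A (g w) - 2 * A w.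
have q0 : q x = 0.
  apply: (@invariant_eq0 q) => w.
    by rewrite -normrN; congr `|_|; have := r0 w; rewrite /r /q; lra.
  have := A_ge0 w; have := A_ge0 (g w); have := A_ge0 (g (g w)).
  by rewrite /q ler_norml => *; apply/andP; split; lra.
move: q0; rewrite /q /A; have [px|/ltW xp] := leP p x.
  have := dec_le px; rewrite gp => gxp.
  by rewrite (ger0_norm (x := x - p)) ?ler0_norm; lra.
have := dec_le xp; rewrite gp => pgx.
by rewrite (ler0_norm (x := x - p)) ?ger0_norm; lra.
Qed.

End WholeLine.

End Additive.

(** * Passage to logarithmic coordinates *)

Section Logarithm.
Set Implicit Arguments.
Unset Strict Implicit.
Variables (R : realType) (J : set R) (f : R -> R).
Hypotheses (J_interval : is_interval J) (J_pos : J `<=` `]0, +oo[%classic).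
Hypothesis f_JJ : set_fun J J f.
Hypothesis f_cont : {within J, continuous f}.
Hypothesis f_eq : forall x, J x -> iter 3 f x = f x ^+ 3 / x ^+ 2.

Definition log_dom : set R := [set x | J (expR x)].
Definition log_conj (x : R) : R := ln (f (expR x)).

Lemma J_gt0 x : J x -> 0 < x.
Proof. by move=> /J_pos; rewrite /= in_itv /= andbT. Qed.

Lemma expR_log_conj x : log_dom x -> expR (log_conj x) = f (expR x).
Proof. by move=> Ix; rewrite lnK // posrE; apply/J_gt0/f_JJ. Qed.

Lemma log_dom_ln x : J x -> log_dom (ln x).
Proof. by move=> Jx; rewrite /log_dom /= lnK // posrE J_gt0. Qed.

Lemma log_dom_interval : is_interval log_dom.
Proof.
move=> x y Ix Iy z /andP[xz zy]; apply: (J_interval Ix Iy).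
by rewrite !ler_expR xz.
Qed.

Lemma log_conj_fun : set_fun log_dom log_dom log_conj.
Proof.
by move=> x Ix; rewrite /log_dom /= expR_log_conj //; exact: f_JJ.
Qed.

Lemma log_conj_continuous : {within log_dom, continuous log_conj}.
Proof.
apply/subspace_continuousP => x Ix.
have fx : f y @[y --> within J (nbhs (expR x))] --> f (expR x).
  exact: (subspace_continuousP J f).1 f_cont _ Ix.
have expx : expR y @[y --> within log_dom (nbhs x)] -->
    within J (nbhs (expR x)).
  (* As [log_dom] is the preimage of [J] under [expR], the restricted filters correspond
     directly. *)
  by move=> B; exact: continuous_expR.
apply: cvg_comp (cvg_comp _ _ expx fx) _.
by apply: continuous_ln; apply/J_gt0/f_JJ.
Qed.

Lemma log_conj_iter3 x : log_dom x ->
  log_conj (log_conj (log_conj x)) = 3 * log_conj x - 2 * x.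
Proof.
move=> Ix; have Igx := log_conj_fun Ix; have fx := J_gt0 (f_JJ Ix).
rewrite {1}/log_conj expR_log_conj // expR_log_conj //.
rewrite [f (f (f _))](f_eq Ix) ln_div ?posrE ?exprn_gt0 ?expR_gt0 //.
by rewrite !lnXn ?expR_gt0 // expRK /log_conj; ring.
Qed.

(** The constant displacement is the logarithm of the slope; the base point [x0] makes it
    explicit. *)
Lemma linear_of_translation x0 : log_dom x0 ->
    (forall x y, log_dom x -> log_dom y ->
       log_conj x - x = log_conj y - y) ->
  forall u, J u -> f u = expR (log_conj x0 - x0) * u.
Proof.
move=> Ix0 trans u Ju; have Iu := log_dom_ln Ju.
have lnuK : expR (ln u) = u by rewrite lnK ?posrE ?J_gt0.
rewrite (trans _ _ Ix0 Iu) -[X in _ = _ * X]lnuK -expRD subrK.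
by rewrite expR_log_conj // lnuK.
Qed.

Lemma log_dom_bounded_above : bounded_set J ->
  exists M, forall x, log_dom x -> x <= M.
Proof.
move=> bddJ; have [M bnd] := @filter_ex _ _ proper_pinfty_nbhs _ bddJ.
exists (ln M) => x Ix.
have expM : expR x <= M by apply: le_trans (ler_norm _) _; exact: bnd.
by rewrite -[x]expRK ler_ln ?posrE ?expR_gt0 // (lt_le_trans (expR_gt0 x)).
Qed.

Lemma log_dom_bounded_below : ~ closure J 0 ->
  exists M, forall x, log_dom x -> M <= x.
Proof.
move=> ncl; apply: contrapT => unbnd; apply: ncl.
move=> B /nbhs_ballP[e /= e_gt0 eB].
have [x Ix xe] : exists2 x, log_dom x & x < ln e.
  apply: contrapT => none; apply: unbnd; exists (ln e) => x Ix.
  by rewrite leNgt; apply/negP => xe; apply: none; exists x.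
exists (expR x); split=> //; apply: eB; rewrite /ball /= sub0r normrN.
by rewrite gtr0_norm ?expR_gt0 // -[e]lnK ?posrE // ltr_expR.
Qed.

End Logarithm.

(** * The four cases of the multiplicative equation *)

Theorem theorem4p2 (R : realType) (J : set R) (f : R -> R)
    (J_interval : is_interval J) (J_nonempty : J !=set0)
    (J_pos : J `<=` `]0, +oo[%classic)
    (f_JJ : set_fun J J f)
    (f_cont : {within J, continuous f})
    (f_eq : forall x, J x -> iter 3 f x = f x ^+ 3 / x ^+ 2) :
  [/\ bounded_set J -> ~ closure J 0 ->
        forall x, J x -> f x = x,
      bounded_set J -> closure J 0 ->
        exists2 c : R, 0 < c <= 1 & forall x, J x -> f x = c * x,
      ~ bounded_set J -> ~ closure J 0 ->
        exists2 c : R, 1 <= c & forall x, J x -> f x = c * x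
    & J = `]0, +oo[%classic ->
        exists2 c : R, 0 < c &
          (forall x, 0 < x -> f x = c * x) \/
          (forall x, 0 < x -> f x = c / x ^+ 2)].
Proof.
have I_itv := log_dom_interval J_interval.
have g_II := log_conj_fun J_pos f_JJ.
have g_cont := log_conj_continuous J_pos f_JJ f_cont.
have g_eq := log_conj_iter3 J_pos f_JJ f_eq.
have linear := linear_of_translation J_pos f_JJ.
have [u Ju] := J_nonempty; have Iu := log_dom_ln J_pos Ju.
split.
- move=> /log_dom_bounded_above[M M_ub] /log_dom_bounded_below[m m_lb] x Jx.
  have trans :=
    translation_of_half_bounded I_itv g_II g_cont g_eq (or_introl M_ub).
  have Ix := log_dom_ln J_pos Jx.
  rewrite (linear _ Ix trans _ Jx).
  have := bounded_above_le I_itv g_II g_cont g_eq M_ub Ix.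
  have := bounded_below_ge I_itv g_II g_cont g_eq m_lb Ix.
  (* Bounds on both sides leave only the zero displacement, hence slope 1. *)
  by move=> ge le; rewrite (le_anti (introT andP (conj le ge))) subrr
    expR0 mul1r.
- move=> /log_dom_bounded_above[M M_ub] _.
  have trans :=
    translation_of_half_bounded I_itv g_II g_cont g_eq (or_introl M_ub).
  exists (expR (log_conj f (ln u) - ln u)); last exact: linear.
  rewrite expR_gt0 -[leRHS]expR0 ler_expR subr_le0.
  exact: bounded_above_le M_ub Iu.
- move=> _ /log_dom_bounded_below[m m_lb].
  have trans :=
    translation_of_half_bounded I_itv g_II g_cont g_eq (or_intror m_lb).
  exists (expR (log_conj f (ln u) - ln u)); last exact: linear.
  rewrite -[leLHS]expR0 ler_expR subr_ge0.
  exact: bounded_below_ge m_lb Iu.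
- move=> J_full.
  have JE x : 0 < x -> J x by rewrite J_full /= in_itv /= andbT.
  have I_full x : log_dom J x by apply: JE; exact: expR_gt0.
  have [g_inc|g_dec] := inc_or_dec I_itv g_cont g_eq.
    have trans := inc_translation I_itv g_II g_cont g_eq g_inc
      (inc_arith g_II g_eq g_inc).
    exists (expR (log_conj f (ln u) - ln u)); first exact: expR_gt0.
    by left=> x /JE; exact: linear.
  have [p gp] := fixpoint_exists I_itv g_cont I_full g_dec.
  exists (expR (3 * p)); first exact: expR_gt0.
  right=> x x_gt0; have lnxK : expR (ln x) = x by rewrite lnK.
  have := expR_log_conj J_pos f_JJ (I_full (ln x)); rewrite lnxK => <-.
  (* Exponentiating [3 p - 2 ln x] gives [c / x^2] with [c = expR (3 p)]. *)
  rewrite (dec_line I_itv g_cont g_eq I_full g_dec gp) expRB; congr (_ / _).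
  by rewrite -[X in X ^+ 2]lnxK -expRM_natl.
Qed.
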